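(* Let $X\subseteq\{0,1\}^n$ be a lattice family with $X=\bigcup_{k=1}^K X_k$, where each $X_k\subseteq X$ is a nonempty lattice family given by a pre-order representation $(I_k^0,I_k^1,D_k)$, and let $f:X\to\mathbb{R}$ be submodular on each $X_k$. For each $k\in[K]$ let $\rho_k$ be the retraction onto $X_k$ defined from $(I_k^0,I_k^1,D_k)$ by $\rho_k(x)=c_k(x\wedge\top_k)\vee\bot_k$, and define $$f_k(x)=f\bigl(\rho_k(x)\bigr)+C\,\|x-\rho_k(x)\|_1\qquad (x\in X),$$ where $C\ge f^U-f^L$ and $f^L\le f(x)\le f^U$ for all $x\in X$. Then each $f_k$ is submodular on $X$ and $$f(x)=\min_{k\in[K]}f_k(x)\qquad\text{for all }x\in X.$$
   Context: $[n]=\{1,\dots,n\}$; $\vee,\wedge$ denote componentwise maximum and minimum; $e_i$ is the $i$-th standard basis vector. A set $X\subseteq\{0,1\}^n$ is a lattice family if it is closed under $\vee$ and $\wedge$. A function $g:X\to\mathbb{R}$ on a lattice family is submodular if $g(x)+g(y)\ge g(x\vee y)+g(x\wedge y)$ for all $x,y\in X$. Pre-order representation: $I_k^0,I_k^1\subseteq[n]$ are index sets and $D_k\subseteq[n]\times[n]$ is a reflexive and transitive relation such that $$X_k=\{x\in\{0,1\}^n\mid x_i=0\ (i\in I_k^0),\ x_i=1\ (i\in I_k^1),\ x_i\ge x_j\ ((i,j)\in D_k)\};$$ it is assumed that $(i,j)\in D_k$ and $i\in I_k^0$ imply $j\in I_k^0$, and that $(i,j)\in D_k$ and $j\in I_k^1$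 imply $i\in I_k^1$. $\top_k:=\sum_{i\notin I_k^0}e_i$ and $\bot_k:=\sum_{i\in I_k^1}e_i$. The closure operator $c_k:\{0,1\}^n\to\{0,1\}^n$ is given by $(c_k(x))_i=\max_{j:(i,j)\in D_k}x_j$ for $i\in[n]$. *)

(* Defs.v *)
From mathcomp Require Import all_boot all_order all_algebra.
From mathcomp Require Import reals.

Set Implicit Arguments.
Unset Strict Implicit.
Unset Printing Implicit Defensive.

Import Order.TTheory GRing.Theory Num.Theory.

Local Open Scope ring_scope.

(* {0,1}^n: coordinates are indexed by 'I_n = {0, .., n-1} instead of
   {1, .., n}, and the entries 0, 1 are the booleans false, true. *)
Notation cube n := {ffun 'I_n -> bool}.

Definition cjoin n (x y : cube n) : cube n := [ffun i => x i || y i].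

Definition cmeet n (x y : cube n) : cube n := [ffun i => x i && y i].

(* The empty family is allowed. *)
Definition lattice_family n (X : {set cube n}) : Prop :=
  forall x y, x \in X -> y \in X -> cjoin x y \in X /\ cmeet x y \in X.

(* A function on X is represented by a total function on the cube whose values
   outside X are arbitrary; when X is a lattice family, only values on X are
   involved here. *)
Definition submodular_on (R : realType) n (X : {set cube n})
    (g : cube n -> R) : Prop :=
  forall x y, x \in X -> y \in X ->
    g (cjoin x y) + g (cmeet x y) <= g x + g y.

Record preorder_rep (n : nat) := PreorderRep {
  I0 : {set 'I_n};
  I1 : {set 'I_n};
  D : rel 'I_n;
  D_refl : reflexive D;
  D_trans : transitive D;
  I0_closed : forall i j, D i j -> i \in I0 -> j \in I0;
  I1_closed : forall i j, D i j -> j \in I1 -> i \in I1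
}.

Definition rep_family n (P : preorder_rep n) : {set cube n} :=
  [set x : cube n | [&& [forall i in I0 P, x i == false],
                        [forall i in I1 P, x i == true] &
                        [forall i, forall j, D P i j ==> (x j <= x i)%N]]].

(* The sum of the e_i over i \notin I0, i.e., the indicator vector of the
   complement of I0. *)
Definition rep_top n (P : preorder_rep n) : cube n := [ffun i => i \notin I0 P].

Definition rep_bot n (P : preorder_rep n) : cube n := [ffun i => i \in I1 P].

(* The iterated || is the maximum of the entries x j. *)
Definition rep_closure n (P : preorder_rep n) (x : cube n) : cube n :=
  [ffun i => \big[orb/false]_(j | D P i j) x j].

Definition retraction n (P : preorder_rep n) (x : cube n) : cube n :=
  cjoin (rep_closure P (cmeet x (rep_top P))) (rep_bot P).

Definition l1dist (R : realType) n (x y : cube n) : R :=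
  \sum_(i < n) `|(x i)%:R - (y i)%:R|.

Definition penalized (R : realType) n (P : preorder_rep n) (f : cube n -> R)
    (C : R) (x : cube n) : R :=
  f (retraction P x) + C * l1dist R x (retraction P x).

Definition is_minimum (R : realType) (T : Type) (F : T -> R) (m : R) : Prop :=
  (exists k, m = F k) /\ (forall k, m <= F k).

(* Main.v *)
Require Import Defs.
From mathcomp Require Import all_boot all_order all_algebra.
From mathcomp Require Import reals.
From mathcomp Require Import lra.

Import Order.TTheory GRing.Theory Num.Theory.

Local Open Scope ring_scope.

(** Two facts carry the proof.

    First, distinct points of the cube are at distance at least 1, so a
    function whose oscillation on [X] is at most [C] is [C]-Lipschitz on [X]
    for the l1-distance ([bounded_lipschitz]).  Applied to [x] and its
    retraction, this says that every penalized function lies above [f]; it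
    agrees with [f] at the fixed points of the retraction, which are the points
    of the represented family, and these families cover [X].

    Second, the retraction [r] preserves joins, while for meets only
    [r (x /\ y) <= r x /\ r y] holds.  Submodularity of [f] on the represented
    family therefore gives the required inequality for [f \o r], except that
    [f (r x /\ r y)] stands where [f (r (x /\ y))] is wanted.  By the Lipschitz
    bound the error is at most [C] times the distance of these two points, and
    that is exactly what the penalty terms provide
    ([l1dist_retraction_modular_defect]): at a coordinate of [I0] the
    retraction vanishes and the penalty is the modular function [x i]; at any
    other coordinate [x i <= r x i], so the penalty is [r x i] minus the
    modular function [x i], and the failure of [r] to preserve the meet is the
    only source of a modular defect. *)

Section Cube.

Variables (R : realType) (n : nat).
Implicit Types x y : cube n.

Lemma l1dist_xx x : l1dist R x x = 0.
Proof. by rewrite /l1dist big1 // => i _; rewrite subrr normr0. Qed.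

Lemma l1dist_ge1 x y : x != y -> 1 <= l1dist R x y.
Proof.
move=> neq_xy; have [i neq_i] : exists i, x i != y i.
  apply/existsP; apply: contraNT neq_xy; rewrite negb_exists => /forallP eq_xy.
  by apply/eqP/ffunP => i; apply/eqP; rewrite -[_ == _]negbK eq_xy.
rewrite /l1dist (bigD1 i) //= ler_wpDr //.
  by apply: sumr_ge0 => j _; apply: normr_ge0.
by case: (x i) (y i) neq_i => [] [] //=;
  rewrite ?subr0 ?sub0r ?normrN normr1.
Qed.

Lemma bounded_lipschitz (X : {set cube n}) (f : cube n -> R) (fL fU C : R) :
  (forall x, x \in X -> fL <= f x <= fU) -> fU - fL <= C ->
  forall x y, x \in X -> y \in X -> f x <= f y + C * l1dist R x y.
Proof.
move=> f_bound leC x y /f_bound/andP[fLx fxU] /f_bound/andP[fLy fyU].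
have [<-|neq_xy] := eqVneq x y; first by rewrite l1dist_xx mulr0 addr0.
have C_ge0 : 0 <= C by lra.
have : C * 1 <= C * l1dist R x y by rewrite ler_wpM2l // l1dist_ge1.
lra.
Qed.

End Cube.

Section Retraction.

Variables (n : nat) (P : preorder_rep n).
Implicit Types x y : cube n.

Lemma rep_closureP x i :
  reflect (exists2 j, D P i j & x j) (rep_closure P x i).
Proof.
rewrite ffunE big_orE.
by apply: (iffP existsP) => [[j /andP[]]|[j Dij xj]]; exists j => //; apply/andP.
Qed.

Lemma retractionP x i :
  reflect (i \in I1 P \/ exists j, [/\ D P i j, x j & j \notin I0 P])
          (retraction P x i).
Proof.
rewrite ffunE [rep_bot P i]ffunE.
apply: (iffP orP) => [[/rep_closureP[j Dij]|]|[|[j [Dij xj jI0]]]].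
- by rewrite !ffunE => /andP[xj jI0]; right; exists j.
- by left.
- by right.
- by left; apply/rep_closureP; exists j => //; rewrite !ffunE xj.
Qed.

Lemma rep_familyP x :
  reflect [/\ forall i, i \in I0 P -> ~~ x i,
              forall i, i \in I1 P -> x i &
              forall i j, D P i j -> x j -> x i]
          (x \in rep_family P).
Proof.
rewrite inE; apply: (iffP and3P) => [[/forall_inP x0 /forall_inP x1 xD]|].
  split=> [i /x0/eqP->|i /x1/eqP|i j Dij xj] //.
  by move/forallP/(_ i)/forallP/(_ j)/implyP/(_ Dij): xD; rewrite xj; case: (x i).
case=> x0 x1 xD; split.
- by apply/forall_inP => i /x0/negPf->.
- by apply/forall_inP => i /x1->.
- apply/forallP => i; apply/forallP => j; apply/implyP => Dij.
  by case xj: (x j); rewrite // (xD i j).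
Qed.

Lemma I01_disjoint i :
  rep_family P != set0 -> i \in I0 P -> i \notin I1 P.
Proof.
by case/set0Pn=> x /rep_familyP[x0 x1 _] /x0; apply: contra => /x1.
Qed.

(** Nonemptiness matters here: an index in both [I0] and [I1] would get the
    value 1 from the bottom element. *)
Lemma retraction_I0 x i :
  rep_family P != set0 -> i \in I0 P -> retraction P x i = false.
Proof.
move=> neP iI0; apply/retractionP => -[|[j [Dij _ /negP]]].
  by apply/negP/I01_disjoint.
by apply; apply: I0_closed Dij iI0.
Qed.

Lemma retraction_in x :
  rep_family P != set0 -> retraction P x \in rep_family P.
Proof.
move=> neP; apply/rep_familyP; split=> [i /retraction_I0->|i iI1|i j Dij] //.
  by apply/retractionP; left.
case/retractionP=> [jI1|[l [Djl xl lI0]]]; apply/retractionP.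
  by left; apply: I1_closed Dij jI1.
by right; exists l; split=> //; apply: D_trans Dij Djl.
Qed.

Lemma retraction_id x : x \in rep_family P -> retraction P x = x.
Proof.
case/rep_familyP=> x0 x1 xD; apply/ffunP => i.
apply/retractionP/idP => [[/x1 //|[j [/xD + xj _]]]|xi]; first exact.
right; exists i; split=> //; first exact: D_refl.
by apply/negP => /x0; rewrite xi.
Qed.

Lemma retraction_join x y :
  retraction P (cjoin x y) = cjoin (retraction P x) (retraction P y).
Proof.
apply/ffunP => i; rewrite [RHS]ffunE; apply/retractionP/orP.
- case=> [iI1|[j [Dij]]]; first by left; apply/retractionP; left.
  by rewrite ffunE => /orP[xj|yj] jI0; [left|right];
    apply/retractionP; right; exists j.
- by case=> /retractionP[|[j [Dij xj jI0]]]; [left| |left|] => //;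
    right; exists j; rewrite ffunE xj ?orbT.
Qed.

Lemma retraction_mono x y :
  (forall i, x i -> y i) -> forall i, retraction P x i -> retraction P y i.
Proof.
move=> le_xy i /retractionP[iI1|[j [Dij xj jI0]]]; apply/retractionP.
  by left.
by right; exists j; split=> //; apply: le_xy.
Qed.

Lemma retraction_meet_le x y i :
  retraction P (cmeet x y) i -> cmeet (retraction P x) (retraction P y) i.
Proof.
move=> rxy; rewrite ffunE; apply/andP.
by split; apply: retraction_mono rxy => j; rewrite ffunE => /andP[].
Qed.

Lemma retraction_ge x i : i \notin I0 P -> x i -> retraction P x i.
Proof.
by move=> iI0 xi; apply/retractionP; right; exists i; split=> //; apply: D_refl.
Qed.

(** The identity holds coordinatewise: by inclusion-exclusion for the 0-1
    values of [x] and [y], and of their retractions, everything cancels but the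
    gap between the retraction of the meet and the meet of the retractions. *)
Lemma l1dist_retraction_modular_defect (R : realType) x y :
  rep_family P != set0 ->
  l1dist R x (retraction P x) + l1dist R y (retraction P y) =
    l1dist R (cjoin x y) (retraction P (cjoin x y)) +
    l1dist R (cmeet x y) (retraction P (cmeet x y)) +
    l1dist R (retraction P (cmeet x y))
             (cmeet (retraction P x) (retraction P y)).
Proof.
move=> neP; rewrite /l1dist -!big_split; apply: eq_bigr => i _ /=.
have le_meet := retraction_meet_le x y i.
have r_I0 z := retraction_I0 z i neP; have r_ge z := retraction_ge z i.
rewrite retraction_join.
move: le_meet (r_I0 x) (r_I0 y) (r_I0 (cmeet x y)).
move: (r_ge x) (r_ge y) (r_ge (cmeet x y)).
move: (retraction P x) (retraction P y) (retraction P (cmeet x y)) => rx ry rm.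
rewrite !ffunE; have [_|_] := boolP (i \in I0 P).
  move=> _ _ _ _ /(_ isT)-> /(_ isT)-> /(_ isT)-> /=.
  by case: (x i); case: (y i); rewrite ?subr0 ?subrr ?normr0 ?normr1; lra.
move=> /(_ isT) + /(_ isT) + /(_ isT) + + _ _ _.
(* Each truth assignment either violates one of the four implications or
   satisfies the identity. *)
case: (x i); case: (y i); case: (rx i); case: (ry i); case: (rm i) => /=;
  do ?[by move=> /(_ isT) | by move=> _ /(_ isT) | by move=> _ _ /(_ isT)
      | by move=> _ _ _ /(_ isT)];
  by rewrite ?subrr ?subr0 ?sub0r ?normrN ?normr0 ?normr1; lra.
Qed.

End Retraction.

Section Penalized.

Variables (R : realType) (n : nat) (X : {set cube n}) (P : preorder_rep n).
Variables (f : cube n -> R) (C : R).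
Hypothesis subPX : rep_family P \subset X.
Hypothesis neP : rep_family P != set0.
Hypothesis f_lip :
  forall x y, x \in X -> y \in X -> f x <= f y + C * l1dist R x y.

Lemma penalized_ge x : x \in X -> f x <= penalized P f C x.
Proof. by move=> xX; apply: f_lip => //; apply/(subsetP subPX)/retraction_in. Qed.

Lemma penalized_id x : x \in rep_family P -> penalized P f C x = f x.
Proof.
by move=> xP; rewrite /penalized retraction_id // l1dist_xx mulr0 addr0.
Qed.

Lemma penalized_submodular :
  lattice_family (rep_family P) -> submodular_on (rep_family P) f ->
  submodular_on X (penalized P f C).
Proof.
move=> latP f_sub x y _ _; rewrite /penalized.
have rP z : retraction P z \in rep_family P by apply: retraction_in.
have := f_sub _ _ (rP x) (rP y); rewrite -retraction_join => f_sub_xy.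
have meet_in := (latP _ _ (rP x) (rP y)).2.
have := f_lip _ _ (subsetP subPX _ (rP (cmeet x y))) (subsetP subPX _ meet_in).
have := congr1 ( *%R C) (l1dist_retraction_modular_defect _ P R x y neP).
rewrite !mulrDr; lra.
Qed.

End Penalized.

Theorem theorem1 (R : realType) (n K : nat)
    (X : {set cube n}) (Xs : 'I_K -> {set cube n})
    (P : 'I_K -> preorder_rep n)
    (f : cube n -> R) (fL fU C : R)
    (hX : lattice_family X)
    (hcover : X = \bigcup_(k < K) Xs k)
    (hsub : forall k, Xs k \subset X)
    (hne : forall k, Xs k != set0)
    (hlat : forall k, lattice_family (Xs k))
    (hrep : forall k, Xs k = rep_family (P k))
    (hsubmod : forall k, submodular_on (Xs k) f)
    (hbound : forall x, x \in X -> fL <= f x <= fU)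
    (hC : fU - fL <= C) :
  (forall k, submodular_on X (penalized (P k) f C)) /\
  (forall x, x \in X -> is_minimum (fun k => penalized (P k) f C x) (f x)).
Proof.
have f_lip := @bounded_lipschitz R n X f fL fU C hbound hC.
split=> [k|x xX].
  by apply: penalized_submodular => //; rewrite -hrep.
split=> [|k]; last by apply: (@penalized_ge R n X) => //; rewrite -hrep.
move: (xX); rewrite {1}hcover => /bigcupP[k _ xk].
by exists k; rewrite penalized_id // -hrep.
Qed.
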